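(* Consider the operator $L=\frac12\frac{d^2}{dx^2}$ in the interval $D=(0,1)$. (i) If the jump measure is deterministic, that is, $\nu=\delta_p$ for some $p\in(0,1)$, then $\gamma_1(\nu)=\lambda_1^D=-2\pi^2$. (ii) If the jump measure $\nu$ (a probability measure on $(0,1)$) is such that the nonzero eigenvalue of $\mathcal{L}$ with the largest real part is real (that is, $\gamma_1(\nu)$ is itself an eigenvalue of $\mathcal{L}$), then $$\gamma_1(\nu)=\lambda_1^D=-2\pi^2.$$
   Context: For a probability measure $\nu$ on $D=(0,1)$ (the jump measure), the operator $\mathcal{L}$ is defined by $\mathcal{L}f=\frac12f''$ on the domain of functions $f\in C^2([0,1])$ (complex-valued functions allowed) such that $f(0)=f(1)=\int_0^1f\,d\nu$. A number $\lambda\in\mathbb{C}$ is an eigenvalue of $\mathcal{L}$ if there is a nonzero $f$ in this domain with $\frac12f''=\lambda f$. It is known that all nonzero eigenvalues have negative real part. The spectral gap is $\gamma_1(\nu)\equiv\sup\{\mathrm{Re}\,\lambda:0\ne\lambda\text{ is an eigenvalue of }\mathcal{L}\}$. $\{\lambda_n^D\}_{n=0}^\infty$ denote the eigenvalues of $\frac12\frac{d^2}{dx^2}$ on $(0,1)$ with the Dirichlet boundary condition, labeled in decreasing order. $\delta_p$ is the unit point mass at $p$. *)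

(* Defs.v *)
From HB Require Import structures.
From mathcomp Require Import all_boot all_order all_algebra.
From mathcomp Require Import complex.
From mathcomp Require Import all_classical all_reals all_analysis.

Set Implicit Arguments.
Unset Strict Implicit.
Unset Printing Implicit Defensive.
Import Order.TTheory GRing.Theory Num.Theory.
Import numFieldNormedType.Exports.
Local Open Scope classical_set_scope.
Local Open Scope complex_scope.
Local Open Scope ring_scope.

(* The topology of R[i] is the one of its modulus. *)
HB.instance Definition _ (R : realType) := NormedModule.copy R[i] R[i]^o.

Section Functions01.
Variable R : realType.
Implicit Types (f : R -> R[i]) (x : R).

(* A function [0,1] -> C is represented by f : R -> R[i]; only its values on
   [0,1] are ever used. *)

Definition diffq01 f x : R -> R[i] := fun y => (f y - f x) / (y - x)%:C.

(* The points y are restricted to [0,1] and distinct from x, so at 0 and 1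
   these are the one-sided notions. *)
Definition derivable01 f x := cvg (diffq01 f x @ within `[0, 1] x^').

Definition derive01 f x : R[i] := lim (diffq01 f x @ within `[0, 1] x^').

Definition C2_01 f : Prop :=
  [/\ forall x, x \in `[0, 1] -> derivable01 f x,
      forall x, x \in `[0, 1] -> derivable01 (derive01 f) x
    & {within `[0, 1], continuous (derive01 (derive01 f))}].

Definition half_D2 f : R -> R[i] := fun x => 2^-1 * derive01 (derive01 f) x.

Definition eigenvalue_on (dom : set (R -> R[i])) (l : R[i]) : Prop :=
  exists2 f, dom f &
    (exists2 x, x \in `[0, 1] & f x != 0) /\
    (forall x, x \in `[0, 1] -> half_D2 f x = l * f x).

End Functions01.

Section JumpOperator.
Variables (R : realType) (nu : probability (measurableTypeR R) R).

(* A probability measure on (0,1) is a probability measure nu on R with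
   nu ]0,1[ = 1. *)
Definition cintegral01 (f : R -> R[i]) : R[i] :=
  (\int[nu]_(x in `]0, 1[) complex.Re (f x)) +i*
  (\int[nu]_(x in `]0, 1[) complex.Im (f x)).

Definition jump_domain : set (R -> R[i]) :=
  [set f | [/\ C2_01 f, f 0 = f 1 & f 1 = cintegral01 f]].

Definition nonzero_eigenvalues : set R[i] :=
  [set l | l != 0 /\ eigenvalue_on jump_domain l].

(* The set is nonempty (it contains - 2 pi ^ 2) and bounded above by 0, so the
   default value 0 of [sup] plays no role. *)
Definition gamma1 : R := sup [set complex.Re l | l in nonzero_eigenvalues].

End JumpOperator.

Section Dirichlet.
Variable R : realType.

Definition dirichlet_domain : set (R -> R[i]) :=
  [set f | [/\ C2_01 f, f 0 = 0 & f 1 = 0]].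

(* All Dirichlet eigenvalues are real and simple: a decreasing labeling with
   multiplicity is a strictly decreasing enumeration. *)
Definition decreasing_dirichlet_labeling : set (nat -> R) :=
  [set lam | (forall n, lam n.+1 < lam n) /\
     forall l : R[i], eigenvalue_on dirichlet_domain l <->
       exists n, l = (lam n)%:C].

(* Such a labeling exists and is unique. *)
Definition lambdaD : nat -> R :=
  xget (fun=> 0) decreasing_dirichlet_labeling.

End Dirichlet.

(* Main.v *)
Require Import Defs.
From mathcomp Require Import all_boot all_order all_algebra.
From mathcomp Require Import complex ring lra.
From mathcomp Require Import all_classical all_reals all_analysis.
From mathcomp Require Import measurable_realfun.
Import Order.TTheory GRing.Theory Num.Theory.
Import numFieldNormedType.Exports.
Local Open Scope classical_set_scope.
Local Open Scope complex_scope.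
Local Open Scope ring_scope.

Set Implicit Arguments.
Unset Strict Implicit.
Unset Printing Implicit Defensive.

(** Let lambda be a nonzero eigenvalue with eigenfunction f and put l = 2 lambda,
    so that f'' = l f on [0, 1] and f 0 = f 1 = the mean of f. The bound
    Re lambda <= - 2 pi^2 follows from a single fact (dirichlet_vanishes_half): if
    Re l > - (2 pi)^2, a solution that vanishes at both ends of an interval of
    length at most 1/2 is zero. It comes from Picone's identity, in which only
    Re l enters; hence complex eigenvalues and eigenfunctions are treated without
    solving the equation by complex exponentials.

    Suppose Re l > - (2 pi)^2. If f takes the same value at c - d and c + d with
    d <= 1/2, then f (c + x) - f (c - x) vanishes at x = 0 and x = d, hence
    identically: f is symmetric about c and f' c = 0 (reflection_critical). Since
    f' solves the same equation, two zeros of f' at distance at most 1/2 force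
    f = 0 (critical_pair).

    For the point mass at p the jump condition reads f 0 = f p = f 1, so f' has
    zeros at the midpoints p / 2 and (1 + p) / 2 of [0, p] and [p, 1]; their
    distance is 1/2, so f = 0.

    For a general measure and a real eigenvalue, f may be taken real. The condition
    f 0 = f 1 makes f symmetric about 1/2 with f' (1/2) = 0, and f' has no further
    zero in (0, 1). Thus f stays strictly on one side of f 1 on (0, 1)
    (strict_extremum_at_ends) and cannot have mean f 1 (real_eigenvalue_le).

    Conversely - 2 pi^2 is an eigenvalue for every measure: the span of
    cos (2 pi x) and sin (2 pi x) is two-dimensional and the mean condition is one
    linear equation on it (fundamental_eigenvalue). So gamma1 = - 2 pi^2 in both
    cases.

    Finally the Dirichlet eigenvalues are - ((n + 1) pi)^2 / 2
    (dirichlet_eigenvalueP), and a strictly decreasing sequence is determined by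
    its range (decreasing_enum_unique), so the eigenvalue of index 1 is
    - 2 pi^2. *)

Local Notation Re := (@complex.Re _).
Local Notation Im := (@complex.Im _).

(** * Primitives of real functions on an interval *)

Section Primitives.
Variable R : realType.
Implicit Types (a b c k m x y : R) (u v w z : R -> R).

(** Differentiability is asked only inside the interval and continuity up to
    its ends: exactly what the mean value theorem uses, and stable under the
    sums, products and affine substitutions below. *)
Definition primitive_on a b u w : Prop :=
  {within `[a, b], continuous u} /\
  forall x, a < x < b -> is_derive x 1 u (w x).

Lemma primitive_on_eq a b u w z : primitive_on a b u w ->
  (forall x, a < x < b -> w x = z x) -> primitive_on a b u z.
Proof. by case=> cu du E; split=> // x ab; rewrite -E //; exact: du. Qed.

Lemma primitive_on_sub a b a' b' u w : a <= a' -> b' <= b ->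
  primitive_on a b u w -> primitive_on a' b' u w.
Proof.
move=> aa' bb' [cu du]; split.
  by apply: continuous_subspaceW cu; apply: subset_itv; rewrite bnd_simp.
move=> x /andP[ax xb]; apply: du.
by rewrite (le_lt_trans aa' ax) (lt_le_trans xb bb').
Qed.

Lemma primitive_on_is_derive a b u w :
  (forall x, a <= x <= b -> is_derive x 1 u (w x)) -> primitive_on a b u w.
Proof.
move=> du; split; last by move=> x /andP[ax xb]; apply: du; rewrite !ltW.
apply: derivable_within_continuous => x; rewrite in_itv /= => xab.
by have [] := du _ xab.
Qed.

Lemma primitive_on_cst a b c : primitive_on a b (fun=> c) (fun=> 0).
Proof. by apply: primitive_on_is_derive => x _; exact: is_derive_cst. Qed.

Lemma primitive_onD a b u v w z :
  primitive_on a b u w -> primitive_on a b v z ->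
  primitive_on a b (fun x => u x + v x) (fun x => w x + z x).
Proof.
move=> [cu du] [cv dv]; split.
  by move=> x; apply: continuousD; [exact: cu | exact: cv].
by move=> x xab; apply: is_deriveD; [exact: du | exact: dv].
Qed.

Lemma primitive_onM a b u v w z :
  primitive_on a b u w -> primitive_on a b v z ->
  primitive_on a b (fun x => u x * v x) (fun x => w x * v x + u x * z x).
Proof.
move=> [cu du] [cv dv]; split.
  by move=> x; apply: continuousM; [exact: cu | exact: cv].
move=> x xab; apply: (@is_derive_eq _ _ _ (u * v)).
  by apply: is_deriveM; [exact: du | exact: dv].
by rewrite /GRing.scale /= addrC (mulrC (v x)).
Qed.

Lemma primitive_onZ a b c u w : primitive_on a b u w ->
  primitive_on a b (fun x => c * u x) (fun x => c * w x).
Proof.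
move=> uw; apply: primitive_on_eq (primitive_onM (primitive_on_cst a b c) uw) _.
by move=> x _; rewrite mul0r add0r.
Qed.

Lemma primitive_onB a b u v w z :
  primitive_on a b u w -> primitive_on a b v z ->
  primitive_on a b (fun x => u x - v x) (fun x => w x - z x).
Proof.
move=> uw vz; have := primitive_onD uw (primitive_onZ (-1) vz).
congr primitive_on; apply/funext => x; ring.
Qed.

Lemma primitive_on_affine a b a' b' c k u w :
  (forall x, a' <= x <= b' -> a <= c + k * x <= b) ->
  (forall x, a' < x < b' -> a < c + k * x < b) ->
  primitive_on a b u w ->
  primitive_on a' b' (fun x => u (c + k * x)) (fun x => k * w (c + k * x)).
Proof.
move=> cl op [cu du].
have dl x : is_derive x 1 (fun y => c + k * y) k.
  apply: (@is_derive_eq _ _ _ (cst c + k \*: id)).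
  by rewrite add0r /GRing.scale /= mulr1.
split; last first.
  move=> x xab; have := du _ (op _ xab) => dux.
  apply: (@is_derive_eq _ _ _ (u \o (fun y => c + k * y))).
  by rewrite /GRing.scale /= mulrC.
apply/subspace_continuousP => x; rewrite /= in_itv /= => xab.
move/subspace_continuousP : cu => /(_ (c + k * x)) /=.
rewrite in_itv /= cl // => /(_ isT) cu.
apply: (@cvg_comp _ _ _ (fun y => c + k * y) u _ _ _ _ cu).
have dx : {for x, continuous (fun y => c + k * y)}.
  by apply/differentiable_continuous/derivable1_diffP; have [] := dl x.
move=> A; rewrite /= /within /= => /dx /=.
rewrite !nbhs_simpl /=; apply: filterS => y /= Ay.
by rewrite in_itv /= => yab; apply: Ay; rewrite in_itv /= cl.
Qed.

Lemma primitive_on_nondecr a b u w : primitive_on a b u w ->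
  (forall x, a < x < b -> 0 <= w x) ->
  forall x y, a <= x -> x <= y -> y <= b -> u x <= u y.
Proof.
move=> uw w0 x y ax xy yb.
have [cu du] := primitive_on_sub ax yb uw.
have du' t : t \in `]x, y[%R -> is_derive t 1 u (w t).
  by rewrite in_itv /=; exact: du.
have [xy'|yx] := ltP x y; last first.
  by rewrite (_ : x = y) //; apply/le_anti; rewrite xy yx.
have [t] := MVT xy' du' cu.
rewrite in_itv /= => /andP[xt ty] E.
rewrite -subr_ge0 E mulr_ge0 ?subr_ge0 ?w0 //.
by rewrite (le_lt_trans ax xt) (lt_le_trans ty yb).
Qed.

Lemma primitive_on_const a b u w : primitive_on a b u w ->
  (forall x, a < x < b -> w x = 0) ->
  forall x y, a <= x <= b -> a <= y <= b -> u x = u y.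
Proof.
move=> uw w0.
have H x y : a <= x -> x <= y -> y <= b -> u x = u y.
  move=> ax xy yb; apply/le_anti/andP; split.
    by apply: (primitive_on_nondecr uw) => // t tab; rewrite w0.
  have uw' := primitive_onZ (-1) uw.
  have := @primitive_on_nondecr _ _ _ _ uw' _ x y ax xy yb.
  rewrite !mulN1r lerN2; by apply => t tab; rewrite w0 // mulr0.
move=> x y /andP[ax xb] /andP[ay yb].
by have [/H ->|/ltW/H ->] := leP x y.
Qed.

Lemma primitive_on_const_deriv a b c u w : primitive_on a b u w ->
  (forall x, a < x < b -> u x = c) -> forall x, a < x < b -> w x = 0.
Proof.
move=> [_ du] uc x xab; have {}du := du x xab.
have dc : is_derive x 1 u 0.
  have xN : x \in `]a, b[%R by rewrite in_itv.
  have uN : \near x, cst c x = u x.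
    by apply: filterS (near_in_itvoo xN) => y; rewrite in_itv /= => /uc ->.
  exact: near_eq_is_derive uN (is_derive_cst c x 1).
by rewrite -(@derive_val _ _ _ _ _ _ _ du) (@derive_val _ _ _ _ _ _ _ dc).
Qed.

(** A nondecreasing function with equal end values is constant. Picone's
    and Lagrange's identities below each produce such a function, with a
    derivative that dominates a positive multiple of |f|^2. *)
Lemma primitive_on_rigid a b u w : primitive_on a b u w ->
  (forall x, a < x < b -> 0 <= w x) -> u a = u b ->
  forall x, a < x < b -> w x = 0.
Proof.
move=> uw w0 uab; apply: (primitive_on_const_deriv (c := u a) uw).
move=> x /andP[ax xb]; have mon := primitive_on_nondecr uw w0.
by apply/le_anti/andP; split; first rewrite uab; apply: mon; rewrite // ltW.
Qed.

End Primitives.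

(** * The equation f'' = l f with complex l *)

Section LinearSystem.
Variable R : realType.
Implicit Types (a b c d k m t x y : R) (l z : R[i]) (f g h : R -> R[i]).

Lemma ReD z l : Re (z + l) = Re z + Re l. Proof. by case: z; case: l. Qed.
Lemma ImD z l : Im (z + l) = Im z + Im l. Proof. by case: z; case: l. Qed.
Lemma ReN z : Re (- z) = - Re z. Proof. by case: z. Qed.
Lemma ImN z : Im (- z) = - Im z. Proof. by case: z. Qed.
Lemma ReM z l : Re (z * l) = Re z * Re l - Im z * Im l.
Proof. by case: z; case: l. Qed.
Lemma ImM z l : Im (z * l) = Re z * Im l + Im z * Re l.
Proof. by case: z; case: l. Qed.
Definition ReImE := (ReD, ImD, ReN, ImN, ReM, ImM).

Lemma complex_ReIm0 z : Re z = 0 -> Im z = 0 -> z = 0.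
Proof. by case: z => p q /= -> ->. Qed.

Definition cprimitive_on a b f g : Prop :=
  primitive_on a b (Re \o f) (Re \o g) /\ primitive_on a b (Im \o f) (Im \o g).

(** The equation f'' = l f as a first-order system for the pair (f, f'); in this
    form (f', l f) is again a solution. *)
Definition solves_on a b l f g : Prop :=
  cprimitive_on a b f g /\ cprimitive_on a b g (fun x => l * f x).

Definition vanishes_on a b f g : Prop :=
  forall x, a <= x <= b -> f x = 0 /\ g x = 0.

Lemma cprimitive_onB a b f g f' g' :
  cprimitive_on a b f g -> cprimitive_on a b f' g' ->
  cprimitive_on a b (fun x => f x - f' x) (fun x => g x - g' x).
Proof.
move=> [fg1 fg2] [fg1' fg2']; split.
  by have := primitive_onB fg1 fg1'; congr primitive_on; apply/funext => x;
    rewrite /= !ReImE.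
by have := primitive_onB fg2 fg2'; congr primitive_on; apply/funext => x;
  rewrite /= !ReImE.
Qed.

Lemma cprimitive_onZ a b l f g : cprimitive_on a b f g ->
  cprimitive_on a b (fun x => l * f x) (fun x => l * g x).
Proof.
move=> [fg1 fg2]; split.
  have := primitive_onB (primitive_onZ (Re l) fg1) (primitive_onZ (Im l) fg2).
  by congr primitive_on; apply/funext => x; rewrite /= !ReImE.
have := primitive_onD (primitive_onZ (Re l) fg2) (primitive_onZ (Im l) fg1).
by congr primitive_on; apply/funext => x; rewrite /= !ReImE.
Qed.

Lemma cprimitive_on_affine a b a' b' c k f g :
  (forall x, a' <= x <= b' -> a <= c + k * x <= b) ->
  (forall x, a' < x < b' -> a < c + k * x < b) ->
  cprimitive_on a b f g ->
  cprimitive_on a' b' (fun x => f (c + k * x)) (fun x => k%:C * g (c + k * x)).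
Proof.
move=> cl op [fg1 fg2]; split.
  have := primitive_on_affine cl op fg1.
  by congr primitive_on; apply/funext => x; rewrite /= !ReImE /=; ring.
have := primitive_on_affine cl op fg2.
by congr primitive_on; apply/funext => x; rewrite /= !ReImE /=; ring.
Qed.

Lemma solves_on_sub a b a' b' l f g : a <= a' -> b' <= b ->
  solves_on a b l f g -> solves_on a' b' l f g.
Proof.
move=> aa' bb' [[? ?] [? ?]].
by do 2!split; apply: primitive_on_sub; eassumption.
Qed.

Lemma solves_on_deriv a b l f g : solves_on a b l f g ->
  solves_on a b l g (fun x => l * f x).
Proof. by case=> ? ?; split => //; exact: cprimitive_onZ. Qed.

(** Picone's identity: compare f with the function v = cos (m (x - c)), which is
    positive on [a, b] when c is the midpoint and m (b - a) < pi. With T = v'/v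
    and g = f', the function P = Re (f^* g) - |f|^2 T vanishes at both ends and
    has derivative |g - f T|^2 + (Re l + m^2) |f|^2 >= 0; the imaginary part of l
    cancels, so that complex l are covered as well. *)
Lemma picone_vanishes a b m l f g : 0 <= m -> m * (b - a) < pi ->
  - m ^+ 2 < Re l ->
  solves_on a b l f g -> f a = 0 -> f b = 0 -> a < b -> vanishes_on a b f g.
Proof.
move=> m0 mab lm [[f1 f2] [g1 g2]] fa fb ab.
set c := (a + b) / 2.
pose T x := - m * tan (m * (x - c)).
have cos0 x : a <= x <= b -> cos (m * (x - c)) != 0.
  move=> xab; rewrite gt_eqF //; apply: cos_gt0_pihalf.
  have h1 : m * (x - a) >= 0 by rewrite mulr_ge0 //; lra.
  have h2 : m * (b - x) >= 0 by rewrite mulr_ge0 //; lra.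
  move: h1 h2; rewrite /c; nra.
have dT : primitive_on a b T (fun x => - (m ^+ 2 + T x ^+ 2)).
  apply: primitive_on_is_derive => x xab.
  have dl : is_derive x 1 (fun y => m * (y - c)) m.
    apply: (@is_derive_eq _ _ _ (m \*: (id - cst c))).
    by rewrite subr0 /GRing.scale /= mulr1.
  have dt := is_derive_tan (cos0 _ xab).
  apply: (@is_derive_eq _ _ _ ((- m) \*: (tan \o (fun y => m * (y - c))))).
  rewrite cos2_tan2 ?cos0 // /GRing.scale /= /T; ring.
have := primitive_onB
  (primitive_onD (primitive_onM f1 g1) (primitive_onM f2 g2))
  (primitive_onM
    (primitive_onD (primitive_onM f1 f1) (primitive_onM f2 f2)) dT).
set P := (X in primitive_on _ _ X _).
pose Q x := (Re (g x) - Re (f x) * T x) ^+ 2 +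
  (Im (g x) - Im (f x) * T x) ^+ 2 +
  (Re l + m ^+ 2) * (Re (f x) ^+ 2 + Im (f x) ^+ 2).
move/(@primitive_on_eq _ _ _ _ _ Q) => PQ.
have {}PQ : primitive_on a b P Q.
  by apply: PQ => x _; rewrite /= !ReImE /Q; ring.
have lm' : 0 < Re l + m ^+ 2 by lra.
have Q0 x : a < x < b -> 0 <= Q x.
  move=> _; apply: addr_ge0; first by apply: addr_ge0; exact: sqr_ge0.
  by rewrite mulr_ge0 ?(ltW lm') // addr_ge0 ?sqr_ge0.
have Pab : P a = P b by rewrite /P /= fa fb /=; ring.
have f0 x : a <= x <= b -> f x = 0.
  move=> /andP[]; rewrite le_eqVlt => /orP[/eqP <- //|ax].
  rewrite le_eqVlt => /orP[/eqP -> //|xb].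
  have : Q x = 0 by apply: (primitive_on_rigid PQ Q0 Pab); rewrite ax.
  move: (sqr_ge0 (Re (g x) - Re (f x) * T x))
    (sqr_ge0 (Im (g x) - Im (f x) * T x)); rewrite /Q => h1 h2 h3.
  have : Re (f x) ^+ 2 + Im (f x) ^+ 2 = 0.
    apply/le_anti; rewrite addr_ge0 ?sqr_ge0 // andbT.
    rewrite -(pmulr_rle0 _ lm'); lra.
  move/eqP; rewrite paddr_eq0 ?sqr_ge0 // !sqrf_eq0 => /andP[/eqP r0 /eqP i0].
  exact: complex_ReIm0.
have cab : a < c < b by rewrite /c; lra.
have gc : g c = 0.
  by apply: complex_ReIm0;
    [apply: (primitive_on_const_deriv (c := 0) f1)
    |apply: (primitive_on_const_deriv (c := 0) f2)] => // y /andP[ay yb];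
    rewrite /= f0 // !ltW.
move=> x xab; split; first exact: f0.
have cab' : a <= c <= b by rewrite /c; lra.
apply: complex_ReIm0.
  have -> : Re (g x) = Re (g c).
    apply: (primitive_on_const g1) => // y /andP[ay yb] /=.
    by rewrite f0 ?mulr0 // !ltW.
  by rewrite gc.
have -> : Im (g x) = Im (g c).
  apply: (primitive_on_const g2) => // y /andP[ay yb] /=.
  by rewrite f0 ?mulr0 // !ltW.
by rewrite gc.
Qed.

(** Picone's identity for some m with -Re l < m^2 < (pi / (b - a))^2. *)
Lemma dirichlet_vanishes a b l f g : a < b -> - (pi / (b - a)) ^+ 2 < Re l ->
  solves_on a b l f g -> f a = 0 -> f b = 0 -> vanishes_on a b f g.
Proof.
move=> ab; set q := pi / (b - a) => ql sol fa fb.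
have q0 : 0 < q by rewrite divr_gt0 ?pi_gt0 // subr_gt0.
pose n := Num.max 0 (- Re l).
have nq : n < q ^+ 2 by rewrite gt_max exprn_gt0 //=; lra.
have n0 : 0 <= n by rewrite le_max lexx.
have nl : - Re l <= n by rewrite le_max lexx orbT.
(* m ^+ 2 is the midpoint between the positive part of - Re l and q ^+ 2 *)
pose m := Num.sqrt ((n + q ^+ 2) / 2).
have m2 : m ^+ 2 = (n + q ^+ 2) / 2 by rewrite sqr_sqrtr //; lra.
have m0 : 0 <= m by exact: sqrtr_ge0.
apply: (@picone_vanishes a b m l) => //; last by lra.
rewrite -ltr_pdivlMr ?subr_gt0 // -(ltr_pXn2r (n := 2)) ?nnegrE ?(ltW q0) //.
by rewrite m2 -/q; lra.
Qed.

(** Gronwall: E = |f|^2 + |f'|^2 satisfies |E'| <= C E, so E exp (-C x) is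
    nonincreasing and E exp (C x) is nondecreasing, which carries a zero of E
    at t to the right and to the left. *)
Lemma solves_on_unique a b l f g t : solves_on a b l f g ->
  a <= t <= b -> f t = 0 -> g t = 0 -> vanishes_on a b f g.
Proof.
move=> [[f1 f2] [g1 g2]] tab ft gt.
pose E x := (Re (f x) * Re (f x) + Im (f x) * Im (f x))
          + (Re (g x) * Re (g x) + Im (g x) * Im (g x)).
have E_ge0 x : 0 <= E x by rewrite !addr_ge0 // -expr2 sqr_ge0.
have [D ED] : {D | primitive_on a b E D &
    forall x, `|D x| <= (1 + `|Re l| + `|Im l|) * E x}.
  eexists; first exact: primitive_onD
    (primitive_onD (primitive_onM f1 f1) (primitive_onM f2 f2))
    (primitive_onD (primitive_onM g1 g1) (primitive_onM g2 g2)).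
  move=> x; rewrite /= !ReImE /E.
  move: (Re (f x)) (Im (f x)) (Re (g x)) (Im (g x)) (Re l) (Im l).
  move=> p q r s al be; set e := p * p + _ + _.
  have e0 : 0 <= e by rewrite !addr_ge0 // -expr2 sqr_ge0.
  have S1 : `|2 * (p * r + q * s)| <= e.
    rewrite ler_norml /e; have := sqr_ge0 (p - r); have := sqr_ge0 (p + r).
    have := sqr_ge0 (q - s); have := sqr_ge0 (q + s); nra.
  have S2 : `|2 * (p * s - q * r)| <= e.
    rewrite ler_norml /e; have := sqr_ge0 (p - s); have := sqr_ge0 (p + s).
    have := sqr_ge0 (q - r); have := sqr_ge0 (q + r); nra.
  rewrite [X in `|X|](_ : _ = (1 + al) * (2 * (p * r + q * s))
    + be * (2 * (p * s - q * r))); last by ring.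
  apply: (le_trans (ler_normD _ _)); rewrite !normrM -!normrM.
  rewrite [leRHS]mulrDl !(normrM (1 + al)) !(normrM be) lerD // ler_pM //.
  by rewrite (le_trans (ler_normD _ _)) // normr1.
set C := (1 + _ + _) => DC.
have dexp (s : R) x : is_derive x 1 (fun y => expR (s * y)) (s * expR (s * x)).
  apply: (@is_derive_eq _ _ _ (expR \o (s \*: id))).
  by rewrite /GRing.scale /= mulr1 mulrC.
have Et : E t = 0 by rewrite /E ft gt /= !mul0r !addr0.
have E0 x : a <= x <= b -> E x = 0.
  move=> xab; apply/le_anti; rewrite E_ge0 andbT.
  have [tx|/ltW xt] := leP t x.
    have := primitive_onZ (-1) (primitive_onM ED
      (primitive_on_is_derive (a := a) (b := b) (fun y _ => dexp (- C) y))).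
    move/primitive_on_nondecr => /(_ _ t x) /= H.
    rewrite -(pmulr_lle0 _ (expR_gt0 (- C * x))).
    have : -1 * (E t * expR (- C * t)) <= -1 * (E x * expR (- C * x)).
      apply: H; [|lra..] => y _; have := expR_gt0 (- C * y).
      by move: (DC y); rewrite ler_norml => /andP[h1 h2] h3; nra.
    rewrite Et; lra.
  have := primitive_onM ED
      (primitive_on_is_derive (a := a) (b := b) (fun y _ => dexp C y)).
  move/primitive_on_nondecr => /(_ _ x t) /= H.
  rewrite -(pmulr_lle0 _ (expR_gt0 (C * x))).
  have : (E x * expR (C * x)) <= (E t * expR (C * t)).
    apply: H; [|lra..] => y _; have := expR_gt0 (C * y).
    by move: (DC y); rewrite ler_norml => /andP[h1 h2] h3; nra.
  rewrite Et; lra.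
move=> x /E0 /eqP; rewrite !paddr_eq0 ?addr_ge0 // -?expr2 ?sqr_ge0 //.
by rewrite !sqrf_eq0 => /andP[/andP[/eqP ? /eqP ?] /andP[/eqP ? /eqP ?]];
  split; apply: complex_ReIm0.
Qed.

(** On intervals of length at most 1/2 the threshold is the one that corresponds
    to the eigenvalue - 2 pi^2, the equation being f'' = 2 lambda f. *)
Lemma dirichlet_vanishes_half a b l f g : a < b -> b - a <= 2^-1 ->
  - (2 * pi) ^+ 2 < Re l ->
  solves_on a b l f g -> f a = 0 -> f b = 0 -> vanishes_on a b f g.
Proof.
move=> ab ba ql; apply: dirichlet_vanishes => //.
apply: le_lt_trans ql; rewrite lerN2 ler_pXn2r ?nnegrE //.
- rewrite ler_pdivlMr ?subr_gt0 //; have := pi_gt0 R; nra.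
- by rewrite mulr_ge0 // pi_ge0.
- by rewrite divr_ge0 ?pi_ge0 // subr_ge0 ltW.
Qed.

(** The odd part h x = f (c + x) - f (c - x) of f about c solves the same
    equation and vanishes at 0 and at d <= 1/2, so it vanishes on [0, d] and
    h' 0 = 2 f' c = 0. *)
Lemma reflection_critical l f g c d : solves_on 0 1 l f g ->
  - (2 * pi) ^+ 2 < Re l -> 0 < d -> d <= 2^-1 -> 0 <= c - d -> c + d <= 1 ->
  f (c - d) = f (c + d) ->
  g c = 0 /\ forall x, 0 <= x <= d -> f (c + x) = f (c - x).
Proof.
move=> [fg gf] ql d0 d2 cd0 cd1 fcd.
have Hp := @cprimitive_on_affine 0 1 0 d c 1.
have Hn := @cprimitive_on_affine 0 1 0 d c (-1).
have {}Hp f' g' : cprimitive_on 0 1 f' g' ->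
  cprimitive_on 0 d (fun x => f' (c + 1 * x)) (fun x => 1%:C * g' (c + 1 * x)).
  by apply: Hp => x; lra.
have {}Hn f' g' : cprimitive_on 0 1 f' g' -> cprimitive_on 0 d
    (fun x => f' (c + -1 * x)) (fun x => (-1)%:C * g' (c + -1 * x)).
  by apply: Hn => x; lra.
have sol : solves_on 0 d l (fun x => f (c + 1 * x) - f (c + -1 * x))
   (fun x => 1%:C * g (c + 1 * x) - (-1)%:C * g (c + -1 * x)).
  split; first exact: cprimitive_onB (Hp _ _ fg) (Hn _ _ fg).
  have := cprimitive_onB (cprimitive_onZ 1%:C (Hp _ _ gf))
    (cprimitive_onZ (-1)%:C (Hn _ _ gf)).
  congr cprimitive_on; apply/funext => x; rewrite rmorphN1 rmorph1; ring.
have V := dirichlet_vanishes_half d0 _ ql sol.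
have {}V := V ltac:(by rewrite subr0) ltac:(by rewrite !mulr0 addr0 subrr)
  ltac:(by rewrite mul1r mulN1r fcd subrr).
split => [|x /V[]]; last first.
  by rewrite mul1r mulN1r => /eqP; rewrite subr_eq0 => /eqP.
have [|_] := V 0; first by rewrite lexx ltW.
rewrite !mulr0 addr0 rmorphN1 rmorph1 mul1r mulN1r opprK -mulr2n => /eqP.
by rewrite mulrn_eq0 => /eqP.
Qed.

(** The derivative g = f' solves the same equation, so its two zeros force g = 0,
    and then l f = g' = 0, between them. *)
Lemma critical_pair l f g s t : solves_on 0 1 l f g -> l != 0 ->
  - (2 * pi) ^+ 2 < Re l -> 0 <= s -> s < t -> t <= 1 -> t <= s + 2^-1 ->
  g s = 0 -> g t = 0 -> vanishes_on 0 1 f g.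
Proof.
move=> sol l0 ql s0 st t1 ts gs gt.
have V : vanishes_on s t g (fun x => l * f x).
  apply: (dirichlet_vanishes_half st _ ql) => //; first by lra.
  exact/solves_on_deriv/(solves_on_sub s0 t1).
have [_ /eqP] := V s ltac:(lra); rewrite mulf_eq0 (negPf l0) /= => /eqP fs.
by apply: (solves_on_unique sol _ fs gs); lra.
Qed.

End LinearSystem.

(** * From one-sided difference quotients to primitives *)

Section OneSidedDerivatives.
Variable R : realType.
Implicit Types (x y a b : R) (z l : R[i]) (u : R -> R) (f : R -> R[i]).

Lemma cvg_ReIm T (F : set_system T) (q : T -> R[i]) z : Filter F ->
  q @ F --> z -> (Re \o q) @ F --> Re z /\ (Im \o q) @ F --> Im z.
Proof.
move=> FF /cvgrPdist_lt qz; split; apply/cvgrPdist_lt => e e0.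
  have /qz : 0 < e%:C by rewrite ltcR.
  apply: filterS => t; rewrite /= -ReN -ReD => h.
  by rewrite -ltcR (le_lt_trans (normc_ge_Re _)).
have /qz : 0 < e%:C by rewrite ltcR.
apply: filterS => t; rewrite /= -ImN -ImD => h.
rewrite -ltcR (le_lt_trans _ h) // normc_def lecR -sqrtr_sqr ler_wsqrtr //.
by rewrite lerDr sqr_ge0.
Qed.

Lemma cvg_real_complex T (F : set_system T) (q : T -> R) x : Filter F ->
  q @ F --> x -> (fun t => (q t)%:C) @ F --> x%:C.
Proof.
move=> FF /cvgrPdist_lt qx; apply/cvgrPdist_lt => e e0.
have /qx : 0 < Re e by move: e0; rewrite ltcE => /andP[].
have eE : (Re e)%:C = e.
  by apply: RRe_real; exact: gtr0_real.
apply: filterS => t; rewrite -(ltcR _ (Re e)) eE => h.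
by rewrite -rmorphB normc_def /= expr0n addr0 sqrtr_sqr.
Qed.

(** The slope function, completed by its limit l at x, is continuous at x within
    A (Caratheodory); this gives both continuity within A up to the boundary and
    the ordinary derivative at interior points. *)
Section OneSided.
Variables (u : R -> R) (x l : R) (A : set R).
Hypothesis ul : (u y - u x) / (y - x) @[y --> within A x^'] --> l.

Let slope y := if y == x then l else (u y - u x) / (y - x).

Let slopeE y : u y - u x = slope y * (y - x).
Proof.
rewrite /slope; case: eqP => [->|/eqP]; first by rewrite !subrr mulr0.
by rewrite -subr_eq0 => /divfK ->.
Qed.

Let slope_cvg : slope @ within A (nbhs x) --> l.
Proof.
move=> N Nl; have := ul Nl; rewrite !nbhs_simpl /= /within /= /dnbhs /within /=.
apply: (@filterS _ (nbhs x)) => y Ny Ay; rewrite /slope.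
case: eqP => [_|/eqP yx].
  exact: nbhs_singleton.
exact: Ny.
Qed.

Lemma diffq_continuous : u @ within A (nbhs x) --> u x.
Proof.
have : (slope y * (y - x) + u x) @[y --> within A (nbhs x)] -->
    l * (x - x) + u x.
  apply: cvgD; last exact: cvg_cst.
  by apply: cvgM => //; apply: cvgB; [exact: cvg_within | exact: cvg_cst].
have -> : (fun y => slope y * (y - x) + u x) = u.
  by apply/funext => y; rewrite -slopeE subrK.
by rewrite subrr mulr0 add0r.
Qed.

Lemma diffq_is_derive : A^° x -> is_derive x 1 u l.
Proof.
have sx : slope x = l by rewrite /slope eqxx.
move=> Aix; apply/is_derive1_caratheodory; exists slope; split=> //.
by have := slope_cvg; rewrite within_interior // -sx.
Qed.

End OneSided.

(** Properness makes the limits that define derive01 unique at every point of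
    [0, 1], the end points included. *)
Lemma unit_itv_within_proper x : 0 <= x <= 1 ->
  ProperFilter (within `[0, 1]%classic x^').
Proof.
move=> x01; apply: Build_ProperFilter_ex => P /=.
rewrite /within /= /dnbhs /within /= => /nbhs_ballP[e /= e0 eP].
pose d := Num.min (e / 2) (1 / 2).
have d0 : 0 < d by rewrite lt_min; lra.
have de : d < e by rewrite gt_min; lra.
have d2 : d <= 1 / 2 by rewrite ge_min lexx orbT.
have [x2|x2] := lerP x (1 / 2).
  exists (x + d); apply: eP; rewrite /= ?in_itv /=; last by lra.
    by rewrite /ball /= opprD addrA subrr add0r normrN gtr0_norm.
  by rewrite -subr_eq0 addrAC subrr add0r gt_eqF.
exists (x - d); apply: eP; rewrite /= ?in_itv /=; last by lra.
  by rewrite /ball /= opprB addrC subrK gtr0_norm.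
by rewrite -subr_eq0 addrAC subrr add0r oppr_eq0 gt_eqF.
Qed.

Lemma Re_diffq f x y : Re (diffq01 f x y) = (Re (f y) - Re (f x)) / (y - x).
Proof. by rewrite /diffq01 -fmorphV ReM /= mulr0 subr0 ReD ReN. Qed.

Lemma Im_diffq f x y : Im (diffq01 f x y) = (Im (f y) - Im (f x)) / (y - x).
Proof. by rewrite /diffq01 -fmorphV ImM /= mulr0 add0r ImD ImN. Qed.

Lemma derivable01_primitive f : (forall x, x \in `[0, 1] -> derivable01 f x) ->
  cprimitive_on 0 1 f (derive01 f).
Proof.
move=> df.
have H x : 0 <= x <= 1 ->
    (Re (f y) - Re (f x)) / (y - x) @[y --> within `[0, 1]%classic x^'] -->
      Re (derive01 f x) /\
    (Im (f y) - Im (f x)) / (y - x) @[y --> within `[0, 1]%classic x^'] -->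
      Im (derive01 f x).
  move=> x01; have /df : x \in `[0, 1] by rewrite in_itv.
  move=> /cvg_ReIm[].
  rewrite /comp /=; under eq_fun do rewrite Re_diffq; move=> h1.
  by under eq_fun do rewrite Im_diffq.
have int x : 0 < x < 1 -> interior (`[0, 1]%classic : set R) x.
  by rewrite interior_itv /= in_itv.
split; split.
- apply/subspace_continuousP => x /=; rewrite in_itv /= => x01.
  by apply: diffq_continuous (H x x01).1.
- move=> x x01; apply: diffq_is_derive (int _ x01).
  by apply: (H x _).1; case/andP: x01 => *; rewrite !ltW.
- apply/subspace_continuousP => x /=; rewrite in_itv /= => x01.
  by apply: diffq_continuous (H x x01).2.
- move=> x x01; apply: diffq_is_derive (int _ x01).
  by apply: (H x _).2; case/andP: x01 => *; rewrite !ltW.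
Qed.

Lemma eigenfunction_solves f l : C2_01 f ->
  (forall x, x \in `[0, 1] -> half_D2 f x = l * f x) ->
  solves_on 0 1 (2 * l) f (derive01 f).
Proof.
move=> [df ddf _] fl; split; first exact: derivable01_primitive.
have [h1 h2] := derivable01_primitive ddf.
have E x : 0 < x < 1 -> derive01 (derive01 f) x = 2 * l * f x.
  move=> /andP[x0 x1]; have /fl : x \in `[0, 1] by rewrite in_itv /= !ltW.
  rewrite /half_D2 -mulrA => <-; rewrite mulrA divff ?mul1r //.
by split; [apply: primitive_on_eq h1 _ | apply: primitive_on_eq h2 _];
  move=> x /E /= ->.
Qed.

Lemma diffq01_real_cvg u f a x : 0 <= x <= 1 -> is_derive x 1 u a ->
  (forall y, 0 <= y <= 1 -> f y = (u y)%:C) ->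
  diffq01 f x @ within `[0, 1]%classic x^' --> a%:C.
Proof.
move=> x01 /is_derive1_caratheodory[g [ug gx <-]] fu.
have : (fun y => (g y)%:C) @ within `[0, 1]%classic x^' --> (g x)%:C.
  apply: cvg_real_complex; apply: cvg_trans gx; apply: cvg_app.
  apply: cvg_trans (cvg_within _) _; exact: cvg_within.
apply: cvg_trans; apply: near_eq_cvg.
rewrite /prop_near1 /= /within /= /dnbhs /within /=.
apply: (@nearW _ (nbhs x)) => y yx; rewrite in_itv /= => y01.
rewrite /diffq01 !fu // -rmorphB ug -fmorphV -rmorphM mulfK //.
by rewrite subr_eq0.
Qed.

(** Smoothness on the whole line turns two-sided derivatives into the one-sided
    ones, which is how the explicit trigonometric eigenfunctions enter. *)
Lemma C2_01_real (u u1 u2 : R -> R) :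
  (forall x, is_derive x 1 u (u1 x)) -> (forall x, is_derive x 1 u1 (u2 x)) ->
  continuous u2 ->
  C2_01 (fun x => (u x)%:C) /\
  forall x, x \in `[0, 1] ->
    half_D2 (fun x => (u x)%:C) x = 2^-1 * (u2 x)%:C.
Proof.
move=> du du1 cu2; set f := fun x => _.
have D1 x : 0 <= x <= 1 ->
    diffq01 f x @ within `[0, 1]%classic x^' --> (u1 x)%:C.
  by move=> x01; exact: diffq01_real_cvg x01 (du x) _.
have E1 x : 0 <= x <= 1 -> derive01 f x = (u1 x)%:C.
  move=> x01; have FF := unit_itv_within_proper x01.
  by apply: cvg_lim; [exact: norm_hausdorff | exact: D1].
have D2 x : 0 <= x <= 1 ->
    diffq01 (derive01 f) x @ within `[0, 1]%classic x^' --> (u2 x)%:C.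
  by move=> x01; exact: diffq01_real_cvg x01 (du1 x) _.
have E2 x : 0 <= x <= 1 -> derive01 (derive01 f) x = (u2 x)%:C.
  move=> x01; have FF := unit_itv_within_proper x01.
  by apply: cvg_lim; [exact: norm_hausdorff | exact: D2].
split; last first.
  by move=> x; rewrite in_itv /= => x01; rewrite /half_D2 E2.
split.
- by move=> x; rewrite in_itv /= => /D1 /cvgP.
- by move=> x; rewrite in_itv /= => /D2 /cvgP.
have : {within `[0, 1], continuous (fun x => (u2 x)%:C)}.
  apply: continuous_subspaceT => x; exact: cvg_real_complex (cu2 x).
apply: subspace_eq_continuous => x; rewrite inE /= in_itv /= => x01.
by rewrite [RHS]E2.
Qed.

End OneSidedDerivatives.

(** * The Dirichlet spectrum *)

Section Dirichlet.
Variable R : realType.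
Implicit Types (k x y a b : R) (z l : R[i]) (u : R -> R) (f g : R -> R[i]).

(** Induction on an integer bound of k / pi, subtracting pi at each step down to
    the interval where sin has no zero. *)
Lemma sin_eq0_pos k : 0 < k -> sin k = 0 -> exists n : nat, k = n.+1%:R * pi.
Proof.
move=> k0; have p0 := pi_gt0 R.
have [N] : exists N : nat, k < N%:R * pi.
  exists (Num.bound (k / pi)); rewrite -ltr_pdivrMr //.
  by apply: archi_boundP; rewrite divr_ge0 // ltW.
elim: N k k0 => [|N IHN] k k0; first by rewrite mul0r ltNge ltW.
move=> kN sk; have [kp|pk|kp] := ltgtP k pi.
- by have := @sin_gt0_pi _ k; rewrite k0 kp sk ltxx => /(_ isT).
- have [|||n kn] := IHN (k - pi).
  + by rewrite subr_gt0.
  + by move: kN; rewrite -natr1 mulrDl mul1r; lra.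
  + by apply: oppr_inj; rewrite -sinDpi subrK oppr0.
  + by exists n.+1; rewrite -natr1 mulrDl mul1r -kn subrK.
- by exists 0%N; rewrite mul1r.
Qed.

(** Lagrange's identity: W = Im (f^* f') vanishes at both ends and has derivative
    Im l |f|^2. Multiplying by Im l makes the derivative nonnegative whatever the
    sign of Im l. *)
Lemma dirichlet_nonreal_vanishes a b l f g : a < b -> solves_on a b l f g ->
  f a = 0 -> f b = 0 -> Im l != 0 -> forall x, a <= x <= b -> f x = 0.
Proof.
move=> ab [[f1 f2] [g1 g2]] fa fb l0.
have := primitive_onZ (Im l)
  (primitive_onB (primitive_onM f1 g2) (primitive_onM f2 g1)).
set W := (X in primitive_on _ _ X _).
pose D x := Im l ^+ 2 * (Re (f x) ^+ 2 + Im (f x) ^+ 2).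
move/(@primitive_on_eq _ _ _ _ _ D) => WD.
have {}WD : primitive_on a b W D.
  by apply: WD => x _; rewrite /= !ReImE /D; ring.
have D0 x : a < x < b -> 0 <= D x.
  by move=> _; rewrite mulr_ge0 ?sqr_ge0 // addr_ge0 ?sqr_ge0.
have Wab : W a = W b by rewrite /W /= fa fb /=; ring.
move=> x /andP[]; rewrite le_eqVlt => /orP[/eqP <- //|ax].
rewrite le_eqVlt => /orP[/eqP -> //|xb].
have /eqP : D x = 0 by apply: (primitive_on_rigid WD D0 Wab); rewrite ax.
rewrite mulf_eq0 sqrf_eq0 (negPf l0) /= paddr_eq0 ?sqr_ge0 // !sqrf_eq0.
by move=> /andP[/eqP ? /eqP ?]; exact: complex_ReIm0.
Qed.

Lemma sin_natpi n : sin (pi *+ n) = 0 :> R.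
Proof.
by elim: n => [|n IHn]; rewrite ?mulr0n ?sin0 // mulrSr sinDpi IHn oppr0.
Qed.

Lemma is_derive_sin_scale k x :
  is_derive x 1 (fun y => sin (k * y)) (k * cos (k * x)).
Proof.
apply: (@is_derive_eq _ _ _ (sin \o (k \*: id))).
by rewrite /GRing.scale /= mulr1 mulrC.
Qed.

Lemma is_derive_cos_scale k x :
  is_derive x 1 (fun y => cos (k * y)) (- k * sin (k * x)).
Proof.
apply: (@is_derive_eq _ _ _ (cos \o (k \*: id))).
by rewrite /GRing.scale /= mulr1 mulrC mulrN mulNr.
Qed.

(** The conserved combination evaluated at both ends gives f' 1 * sin k = 0, and
    f' 1 = 0 together with f 1 = 0 would make f vanish. *)
Lemma dirichlet_sin k f g : 0 < k -> solves_on 0 1 (- k ^+ 2)%:C f g ->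
  f 0 = 0 -> f 1 = 0 -> (exists2 x, 0 <= x <= 1 & f x != 0) -> sin k = 0.
Proof.
move=> k0 sol f0 f1 [t t01 ft].
(* The combination k * u * cos (k x) - u' * sin (k x) is conserved. *)
have B u w : primitive_on 0 1 u w ->
    primitive_on 0 1 w (fun x => - k ^+ 2 * u x) ->
    u 0 = 0 -> u 1 = 0 -> w 1 * sin k = 0.
  move=> uw wu u0 u1.
  have ps : primitive_on 0 1 _ _ :=
    primitive_on_is_derive (fun y _ => is_derive_sin_scale k y).
  have pc : primitive_on 0 1 _ _ :=
    primitive_on_is_derive (fun y _ => is_derive_cos_scale k y).
  have := primitive_onB (primitive_onZ k (primitive_onM uw pc))
    (primitive_onM wu ps).
  move/primitive_on_const => /(_ _ 1 0) /=.
  rewrite u0 u1 !mul0r !mulr0 sin0 mulr0 mulr1 !sub0r => H.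
  apply/eqP; rewrite -oppr_eq0; apply/eqP; rewrite H ?oppr0 //.
  - by move=> x _; ring.
  - by rewrite ler01 lexx.
  - by rewrite ler01 lexx.
have [[f01 f02] [g01 g02]] := sol.
apply/eqP; apply: contraT => sk.
have g1 : g 1 = 0.
  apply: complex_ReIm0; apply/eqP; rewrite -(mulIr_eq0 _ (mulIf sk)); apply/eqP.
  - apply: (B _ _ f01) => /=; rewrite ?f0 ?f1 //.
    by apply: primitive_on_eq g01 _ => x _ /=; rewrite !ReImE /=; ring.
  - apply: (B _ _ f02) => /=; rewrite ?f0 ?f1 //.
    by apply: primitive_on_eq g02 _ => x _ /=; rewrite !ReImE /=; ring.
have i1 : 0 <= (1 : R) <= 1 by rewrite ler01 lexx.
have [fE _] := solves_on_unique sol i1 f1 g1 t01.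
by rewrite fE eqxx in ft.
Qed.

Definition dirichlet_value (n : nat) : R := - (n.+1%:R * pi) ^+ 2 / 2.

(** An eigenvalue is real by Lagrange's identity and negative by Picone's; writing
    it - k^2 / 2 with k > 0, the conserved combination gives sin k = 0. *)
Lemma dirichlet_eigenvalueP l : eigenvalue_on (@dirichlet_domain R) l <->
  exists n, l = (dirichlet_value n)%:C.
Proof.
split; last first.
  move=> [n ->]; pose k : R := n.+1%:R * pi.
  have k0 : 0 < k by rewrite mulr_gt0 ?pi_gt0.
  have [] := @C2_01_real _ (fun x => sin (k * x)) (fun x => k * cos (k * x))
    (fun x => - k ^+ 2 * sin (k * x)).
  - by move=> x; exact: is_derive_sin_scale.
  - move=> x; have H := is_derive_cos_scale k x.
    apply: (@is_derive_eq _ _ _ (k \*: (fun y => cos (k * y)))).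
    by rewrite /GRing.scale /=; ring.
  - move=> x; apply/differentiable_continuous/derivable1_diffP.
    by have [d _] := is_derive_sin_scale k x; exact: derivableZ.
  set f := fun x => _; move=> C2f half; exists f.
    split => //; first by rewrite /f mulr0 sin0.
    by rewrite /f mulr1 /k mulr_natl sin_natpi.
  split; last first.
    move=> x /half ->; rewrite /f /dirichlet_value -/k.
    have -> : (2^-1 : R[i]) = (2^-1 : R)%:C by rewrite fmorphV rmorph_nat.
    by rewrite -!rmorphM; congr (_%:C); rewrite /=; field.
  (* the first maximum of the eigenfunction, where k * x = pi / 2 *)
  exists (2 * n.+1%:R)^-1.
    rewrite in_itv /= invr_ge0 mulr_ge0 //=.
    by rewrite invf_le1 ?mulr_gt0 // -natrM ler1n.
  rewrite /f /k (_ : _ * _ = pi / 2); last by field.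
  by rewrite sin_pihalf oner_neq0.
move=> [f [C2f f0 f1] [[t t01 ft] fl]].
have sol := eigenfunction_solves C2f fl.
rewrite in_itv /= in t01.
have iml : Im (2 * l) = 0.
  apply/eqP; apply: contraT => l0.
  by rewrite (dirichlet_nonreal_vanishes ltr01 sol f0 f1 l0 t01) eqxx in ft.
have rel : Re (2 * l) < 0.
  rewrite ltNge; apply: contraNN ft => l0; apply/eqP.
  apply: (dirichlet_vanishes ltr01 _ sol f0 f1 t01).1.
  rewrite (lt_le_trans _ l0) // oppr_lt0 exprn_gt0 //.
  by rewrite divr_gt0 ?pi_gt0 // subr0.
pose k := Num.sqrt (- Re (2 * l)).
have k0 : 0 < k by rewrite sqrtr_gt0; lra.
have k2 : k ^+ 2 = - Re (2 * l) by rewrite sqr_sqrtr //; lra.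
have l2 : 2 * l = (- k ^+ 2)%:C.
  apply/eqP; rewrite eq_complex; apply/andP; split; apply/eqP.
    by rewrite k2 opprK.
  exact: iml.
rewrite l2 in sol.
have [|n kn] := @sin_eq0_pos k k0.
  by apply: (dirichlet_sin k0 sol f0 f1); exists t.
exists n; apply: (@mulfI _ (2 : R[i])); first by rewrite pnatr_eq0.
rewrite l2 /dirichlet_value -kn.
have -> : (2 : R[i]) = (2 : R)%:C by rewrite rmorph_nat.
by rewrite -rmorphM; congr (_%:C); field.
Qed.

(** s n is some t j, and j < n is excluded since it would repeat s j. *)
Lemma decreasing_enum_le (s t : nat -> R) n :
  (forall i j, (s i <= s j) = (j <= i)%N) ->
  (forall i j, (t i <= t j) = (j <= i)%N) ->
  (forall i, exists j, s i = t j) -> (forall i, (i < n)%N -> s i = t i) ->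
  s n <= t n.
Proof.
move=> ds dt st eqst; have [j sj] := st n.
rewrite sj dt leqNgt; apply/negP => jn.
by move: (ds j n); rewrite sj -eqst // lexx leqNgt jn.
Qed.

Lemma decreasing_enum_unique (s t : nat -> R) :
  (forall n, s n.+1 < s n) -> (forall n, t n.+1 < t n) ->
  (forall x, (exists n, x = s n) <-> exists n, x = t n) -> s =1 t.
Proof.
move=> /Order.NatMonotonyTheory.decnP ds /Order.NatMonotonyTheory.decnP dt st.
elim/ltn_ind => n IHn.
have st' i : exists j, s i = t j by apply/st; exists i.
have ts' i : exists j, t i = s j by apply/st; exists i.
by apply/le_anti; rewrite !decreasing_enum_le // => i /IHn.
Qed.

Lemma lambdaD_value n : lambdaD R n = dirichlet_value n.
Proof.
have H : decreasing_dirichlet_labeling dirichlet_value.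
  split; last exact: dirichlet_eigenvalueP.
  move=> m; rewrite /dirichlet_value ltr_pM2r ?invr_gt0 // ltrN2.
  rewrite ltr_pXn2r ?nnegrE ?mulr_ge0 ?pi_ge0 ?ler0n //.
  by rewrite ltr_pM2r ?pi_gt0 // ltr_nat.
have [d1 d2] : decreasing_dirichlet_labeling (lambdaD R).
  by rewrite /lambdaD; case: xgetP => [//|/(_ _ H)].
have [h1 _] := H.
apply: decreasing_enum_unique => // x; split => -[m xm].
  have : exists n, x%:C = (lambdaD R n)%:C by exists m; rewrite xm.
  by move/d2/dirichlet_eigenvalueP => [j /complexI]; exists j.
have : exists n, x%:C = (dirichlet_value n)%:C by exists m; rewrite xm.
by move/dirichlet_eigenvalueP/d2 => [j /complexI]; exists j.
Qed.

Lemma lambdaD1 : lambdaD R 1 = - 2 * pi ^+ 2.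
Proof. by rewrite lambdaD_value /dirichlet_value; field. Qed.

End Dirichlet.

(** * Real solutions above the threshold *)

Section RealCase.
Variable R : realType.
Implicit Types (r x y a b t : R) (z l : R[i]) (u w : R -> R) (f g : R -> R[i]).

Lemma solves_on_real r a b u w : primitive_on a b u w ->
  primitive_on a b w (fun x => r * u x) ->
  solves_on a b r%:C (fun x => (u x)%:C) (fun x => (w x)%:C).
Proof.
move=> uw wu; split; split=> //; try exact: primitive_on_cst.
  by apply: primitive_on_eq wu _ => x _ /=; ring.
apply: primitive_on_eq (primitive_on_cst a b 0) _ => x _.
by rewrite /=; ring.
Qed.

(** Reflection in 1/2 makes u symmetric with a critical point at 1/2, and u has
    no other critical point t between 1/2 and 1 by critical_pair. By Rolle u
    takes the value u 1 nowhere in [1/2, 1), so by the intermediate value theorem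
    u stays on one side of it, and on (0, 1/2] by symmetry. *)
Lemma strict_extremum_at_ends r u w : primitive_on 0 1 u w ->
  primitive_on 0 1 w (fun x => r * u x) -> r != 0 -> - (2 * pi) ^+ 2 < r ->
  u 0 = u 1 -> (exists2 x, 0 <= x <= 1 & u x != 0) ->
  (forall x, 0 < x < 1 -> u x < u 1) \/ (forall x, 0 < x < 1 -> u 1 < u x).
Proof.
move=> uw wu r0 rpi u01 [z z01 uz].
have sol := solves_on_real uw wu.
have [||||| ] := reflection_critical (c := 2^-1) (d := 2^-1) sol rpi.
- by rewrite invr_gt0.
- by [].
- by rewrite subrr.
- by lra.
- by rewrite subrr -mulr2n -[_ *+ 2]mulr_natl mulfV ?pnatr_eq0 // u01.
move=> [w2] sym.
have symm x : 0 <= x <= 2^-1 -> u (2^-1 + x) = u (2^-1 - x).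
  by move/sym => /complexI.
have neq y : 2^-1 <= y < 1 -> u y != u 1.
  move=> y21; apply/eqP => uy.
  have [cu du] := @primitive_on_sub _ 0 1 y 1 u w ltac:(lra) ltac:(lra) uw.
  have [||t] := @Rolle _ u y 1 _ _ cu uy; first by lra.
    by move=> x; rewrite in_itv /= => /du [].
  rewrite in_itv /= => yt dt.
  have wt : w t = 0.
    rewrite -(@derive_val _ _ _ _ _ _ _ (du t yt)).
    by rewrite (@derive_val _ _ _ _ _ _ _ dt).
  have r0' : r%:C != 0 by rewrite fmorph_eq0.
  have [||||||] :=
    critical_pair (s := 2^-1) (t := t) sol r0' rpi _ _ _ _ _ _ z01.
  - by rewrite invr_ge0.
  - by lra.
  - by lra.
  - by lra.
  - by rewrite w2.
  - by rewrite wt.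
  by move=> /complexI uz0; rewrite uz0 eqxx in uz.
have [cu _] := uw.
have side y : 2^-1 <= y < 1 -> (u y < u 1) = (u 2^-1 < u 1).
  move=> y21; have n1 := neq _ y21.
  have n2 := neq 2^-1 ltac:(lra).
  have noval : ~~ (Num.min (u 2^-1) (u y) <= u 1 <= Num.max (u 2^-1) (u y)).
    apply/negP => mm.
    have [||c] := @IVT _ u 2^-1 y (u 1) _ _ mm; first by lra.
      apply: continuous_subspaceW cu; apply: subset_itv;
        by rewrite bnd_simp; lra.
    rewrite in_itv /= => c2 /eqP; apply/negP; apply: neq; lra.
  move: noval; rewrite ge_min le_max.
  case: (ltgtP (u y) (u 1)) n1 => // _ _.
    by case: (ltgtP (u 2^-1) (u 1)) n2.
  by case: (ltgtP (u 2^-1) (u 1)) n2.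
have side' x : 0 < x < 1 -> (u x < u 1) = (u 2^-1 < u 1) /\ u x != u 1.
  move=> x01; have [x2|x2] := lerP 2^-1 x.
    by rewrite side ?neq //; lra.
  have := symm (2^-1 - x) ltac:(lra).
  rewrite subKr => <-.
  by rewrite side ?neq //; lra.
have [h|h] := ltP (u 2^-1) (u 1); [left|right] => x /side' [E n].
  by rewrite E.
by rewrite lt_neqAle eq_sym n leNgt E -leNgt.
Qed.

End RealCase.

(** * The jump operator of a general measure *)

Section Integral.
Variables (R : realType) (nu : probability (measurableTypeR R) R).
Implicit Types (u v : R -> R) (c : R).
Local Notation D := (`]0, 1[%classic : set R).

Lemma continuous01_measurable u : {within `[0, 1], continuous u} ->
  measurable_fun (D : set (measurableTypeR R)) u.
Proof.
move=> cu; apply: subspace_continuous_measurable_fun => //.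
by apply: continuous_subspaceW cu; exact: subset_itv_oo_cc.
Qed.

Lemma continuous01_integrable u : {within `[0, 1], continuous u} ->
  nu.-integrable D (EFin \o u).
Proof.
move=> cu; apply: measurable_bounded_integrable => //.
- by rewrite (le_lt_trans (probability_le1 nu _)) ?ltry.
- exact: continuous01_measurable.
have /compact_bounded[M [_ mrt]] :=
  continuous_compact cu (@segment_compact _ 0 1).
exists M; split; rewrite ?num_real // => m Mm x /= x01.
by apply: mrt => //; exists x => //=; exact: subset_itv_oo_cc.
Qed.

Hypothesis nuD : nu D = 1%E.

(** A nonnegative function with integral 0 vanishes almost everywhere, whereas u
    vanishes nowhere on a set of measure 1. *)
Lemma integral_gt0 u : {within `[0, 1], continuous u} ->
  (forall x, 0 < x < 1 -> 0 < u x) -> 0 < \int[nu]_(x in D) u x.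
Proof.
move=> cu u0; have iu := continuous01_integrable cu.
have mD : measurable (D : set (measurableTypeR R)) by [].
have mu := continuous01_measurable cu.
have E0 : (0 <= \int[nu]_(x in D) (u x)%:E)%E.
  by apply: integral_ge0 => x /=; rewrite in_itv /= lee_fin => /u0 /ltW.
rewrite lt_neqAle fine_ge0 // andbT eq_sym; apply/negP => /eqP I0.
have I0' : (\int[nu]_(x in D) (u x)%:E = 0)%E.
  by rewrite -(fineK (integrable_fin_num _ iu)) //; congr EFin.
have : (\int[nu]_(x in D) `|(u x)%:E| = 0)%E.
  rewrite -[RHS]I0'; apply: eq_integral => x.
  rewrite inE /= in_itv /= => /u0 ux.
  by rewrite gtr0_norm.
have mEu : measurable_fun (D : set (measurableTypeR R)) (EFin \o u).
  exact/measurable_EFinP.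
move/(ae_eq_integral_abs nu mD mEu) => [N [mN N0 sub]].
have : (1 <= nu N)%E.
  rewrite -nuD; apply: le_measure; rewrite ?inE // => x Dx.
  apply: sub => /= /(_ Dx) [].
  by move: Dx; rewrite /= in_itv /= => /u0; rewrite lt0r => /andP[/eqP].
by rewrite N0 lee_fin ler10.
Qed.

Lemma integral_cst01 c : \int[nu]_(x in D) c = c.
Proof.
rewrite Rintegral_cst // -[RHS]mulr1; congr (_ * _); exact: (congr1 fine nuD).
Qed.

Lemma cst_integrable c : nu.-integrable D (EFin \o cst c).
Proof. exact: finite_measure_integrable_cst. Qed.

Lemma integral_lt_cst u c : {within `[0, 1], continuous u} ->
  (forall x, 0 < x < 1 -> u x < c) -> \int[nu]_(x in D) u x < c.
Proof.
move=> cu uc; rewrite -subr_gt0 -{1}(integral_cst01 c) -RintegralB //=.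
- apply: integral_gt0 => [x|x /uc]; last by rewrite subr_gt0.
  by apply: continuousB; [exact: cst_continuous | exact: cu].
- exact: cst_integrable.
- exact: continuous01_integrable.
Qed.

Lemma cst_lt_integral u c : {within `[0, 1], continuous u} ->
  (forall x, 0 < x < 1 -> c < u x) -> c < \int[nu]_(x in D) u x.
Proof.
move=> cu uc; rewrite -subr_gt0 -{1}(integral_cst01 c) -RintegralB //=.
- apply: integral_gt0 => [x|x /uc]; last by rewrite subr_gt0.
  by apply: continuousB; [exact: cu | exact: cst_continuous].
- exact: continuous01_integrable.
- exact: cst_integrable.
Qed.

(** For real r the real and imaginary parts of an eigenfunction are themselves
    solutions; above the threshold a nonzero one has its strict extremum at the
    end points, so its mean differs from its boundary value. *)
Lemma real_eigenvalue_le r : nonzero_eigenvalues nu r%:C -> r <= - 2 * pi ^+ 2.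
Proof.
move=> [l0 [f [C2f f01 f1] [[t t01 ft] fl]]].
rewrite leNgt; apply/negP => rpi.
have [fg gf] := eigenfunction_solves C2f fl.
have r0 : r != 0 by rewrite fmorph_eq0 in l0.
have r20 : 2 * r != 0 by rewrite mulf_neq0 // pnatr_eq0.
have r2pi : - (2 * pi) ^+ 2 < 2 * r by move: rpi; rewrite exprMn; lra.
have two : (2 : R[i]) = (2 : R)%:C by rewrite rmorph_nat.
have K u w : primitive_on 0 1 u w ->
    primitive_on 0 1 w (fun x => 2 * r * u x) ->
    u 0 = u 1 -> u 1 = \int[nu]_(x in D) u x ->
    forall x, 0 <= x <= 1 -> u x = 0.
  move=> uw wu u01 u1 x x01; apply/eqP; apply: contraT => ux.
  have unz : exists2 y, 0 <= y <= 1 & u y != 0 by exists x.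
  have [H|H] := strict_extremum_at_ends uw wu r20 r2pi u01 unz.
    by have := integral_lt_cst uw.1 H; rewrite -u1 ltxx.
  by have := cst_lt_integral uw.1 H; rewrite -u1 ltxx.
rewrite in_itv /= in t01.
move/negP: ft; apply; apply/eqP; apply: complex_ReIm0.
  apply: (K _ _ fg.1 _ _ _ _ t01) => /=.
  - apply: primitive_on_eq gf.1 _ => x _.
    by rewrite /= two -rmorphM ReM /=; ring.
  - by rewrite f01.
  - by rewrite {1}f1.
apply: (K _ _ fg.2 _ _ _ _ t01) => /=.
- apply: primitive_on_eq gf.2 _ => x _.
    by rewrite /= two -rmorphM ImM /=; ring.
- by rewrite f01.
- by rewrite {1}f1.
Qed.

(** Every combination of cos (2 pi x) and sin (2 pi x) takes equal values at 0 and
    1. With c and s the means of these two functions, the coefficients s and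
    1 - c make the boundary value s equal to the mean s c + (1 - c) s; they are
    not both zero because c < 1. *)
Lemma fundamental_eigenvalue : nonzero_eigenvalues nu (- 2 * pi ^+ 2)%:C.
Proof.
have p0 := pi_gt0 R.
split.
  by rewrite fmorph_eq0 mulf_neq0 ?oppr_eq0 ?pnatr_eq0 ?sqrf_eq0 ?gt_eqF.
pose k : R := 2 * pi.
have ccos : continuous (fun x => cos (k * x)).
  by move=> x; apply/differentiable_continuous/derivable1_diffP;
    have [] := is_derive_cos_scale k x.
have csin : continuous (fun x => sin (k * x)).
  by move=> x; apply/differentiable_continuous/derivable1_diffP;
    have [] := is_derive_sin_scale k x.
have icos := continuous01_integrable (continuous_subspaceT ccos).
have isin := continuous01_integrable (continuous_subspaceT csin).
set c := \int[nu]_(x in D) cos (k * x).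
set s := \int[nu]_(x in D) sin (k * x).
have c1 : c < 1.
  apply: integral_lt_cst; first exact: continuous_subspaceT.
  move=> x /andP[x0 x1].
  have -> : k * x = (pi * x) *+ 2 by rewrite /k mulr2n; ring.
  rewrite cos_mulr2n.
  have : 0 < sin (pi * x) by apply: sin_gt0_pi; rewrite mulr_gt0 //=; nra.
  by have := cos2Dsin2 (pi * x); rewrite mulr2n; nra.
pose u x := s * cos (k * x) + (1 - c) * sin (k * x).
have [] := @C2_01_real _ u
  (fun x => s * (- k * sin (k * x)) + (1 - c) * (k * cos (k * x)))
  (fun x => - k ^+ 2 * u x).
- move=> x; have h1 := is_derive_cos_scale k x.
  have h2 := is_derive_sin_scale k x.
  exact: (is_deriveD (is_deriveZ s h1) (is_deriveZ (1 - c) h2)).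
- move=> x; have h1 := is_derive_cos_scale k x.
  have h2 := is_derive_sin_scale k x.
  apply: (is_derive_eq (is_deriveD (is_deriveZ s (is_deriveZ (- k) h2))
     (is_deriveZ (1 - c) (is_deriveZ k h1)))).
  rewrite /GRing.scale /= /u; ring.
- move=> x; apply: cvgM; first exact: cvg_cst.
  apply: cvgD; apply: cvgM; [exact: cvg_cst | exact: ccos | exact: cvg_cst |].
  exact: csin.
set f := fun x => _; move=> C2f half.
have cos2pi : cos k = 1 by rewrite /k mulr_natl cos2pi.
have sin2pi : sin k = 0 by rewrite /k mulr_natl sin2pi.
have f0 : f 0 = s%:C by rewrite /f /u mulr0 cos0 sin0; congr (_%:C); ring.
have f1 : f 1 = s%:C by rewrite /f /u mulr1 cos2pi sin2pi; congr (_%:C); ring.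
exists f.
  split => //; first by rewrite f0 f1.
  rewrite f1; apply/eqP; rewrite eq_complex; apply/andP; split; apply/eqP => /=.
    rewrite /u RintegralD //; last 2 first.
    + apply/continuous01_integrable/continuous_subspaceT => x.
      by apply: cvgM; [exact: cvg_cst | exact: ccos].
    + apply/continuous01_integrable/continuous_subspaceT => x.
      by apply: cvgM; [exact: cvg_cst | exact: csin].
    rewrite !RintegralZl // -/c -/s; ring.
  by rewrite integral_cst01.
split.
  (* at 1/4 the cosine vanishes and f takes the value 1 - c *)
  exists 4^-1; first by rewrite in_itv /= invr_ge0 ler0n /= invf_le1 // ler1n.
  rewrite /f /u fmorph_eq0 /k (_ : 2 * pi * 4^-1 = pi / 2); last by field.
  by rewrite cos_pihalf sin_pihalf mulr0 add0r mulr1 subr_eq0 gt_eqF.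
move=> x /half ->; rewrite /f.
have -> : (2^-1 : R[i]) = (2^-1 : R)%:C by rewrite fmorphV rmorph_nat.
by rewrite -!rmorphM; congr (_%:C); rewrite /= /k; field.
Qed.

(** If the real parts had no supremum, gamma1 would be the default value 0 of sup,
    which is not a nonzero eigenvalue. *)
Lemma gamma1_real : nonzero_eigenvalues nu (gamma1 nu)%:C ->
  gamma1 nu = - 2 * pi ^+ 2.
Proof.
move=> g; apply/le_anti; rewrite real_eigenvalue_le //=.
have hs : has_sup [set Re l | l in nonzero_eigenvalues nu].
  apply: contrapT => /sup_out g0.
  by have [] := g; rewrite /gamma1 g0 eqxx.
apply: ub_le_sup; first by case: hs.
by exists (- 2 * pi ^+ 2)%:C => //; exact: fundamental_eigenvalue.
Qed.

End Integral.

(** * The jump operator of a point mass *)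

Section Deterministic.
Variable R : realType.
Implicit Types (p x : R) (l : R[i]) (f : R -> R[i]).
Local Notation delta p := (@dirac _ (measurableTypeR R) p R).

Lemma cintegral01_dirac p f : 0 < p < 1 ->
  {within `[0, 1], continuous (Re \o f)} ->
  {within `[0, 1], continuous (Im \o f)} ->
  cintegral01 (delta p) f = f p.
Proof.
move=> p01 cRe cIm.
have E (u : R -> R) : {within `[0, 1], continuous u} ->
    \int[delta p]_(x in `]0, 1[%classic) u x = u p.
  move=> cu; rewrite /Rintegral integral_dirac //; last first.
    by apply/measurable_EFinP; exact: continuous01_measurable cu.
  by rewrite diracE mem_set ?mul1e //= in_itv.
by rewrite /cintegral01 (E _ cRe) (E _ cIm) /=; case: (f p).
Qed.

(** Here f 0 = f p = f 1. Reflecting [0, p] and [p, 1] in their midpoints gives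
    zeros of f' at p / 2 and (1 + p) / 2, whose distance is exactly 1/2. *)
Lemma Re_dirac_eigenvalue_le p l : 0 < p < 1 ->
  nonzero_eigenvalues (delta p) l -> Re l <= - 2 * pi ^+ 2.
Proof.
move=> p01 [l0 [f [C2f f01 f1] [[t t01 ft] fl]]].
rewrite leNgt; apply/negP => rpi.
have sol := eigenfunction_solves C2f fl.
have [[fRe _] [fIm _]] := sol.1.
rewrite (cintegral01_dirac p01 fRe fIm) in f1.
have two : (2 : R[i]) = (2 : R)%:C by rewrite rmorph_nat.
have l20 : 2 * l != 0 by rewrite mulf_neq0 // pnatr_eq0.
have l2pi : - (2 * pi) ^+ 2 < Re (2 * l).
  by rewrite two ReM /= exprMn; move: rpi; lra.
have [||||| g1 _] := reflection_critical (c := p / 2) (d := p / 2) sol l2pi.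
- by lra.
- by lra.
- by lra.
- by lra.
- by rewrite subrr -splitr f01 f1.
have [||||| g2 _] :=
  reflection_critical (c := (1 + p) / 2) (d := (1 - p) / 2) sol l2pi.
- by lra.
- by lra.
- by lra.
- by lra.
- rewrite (_ : (1 + p) / 2 - (1 - p) / 2 = p); last by field.
  by rewrite (_ : (1 + p) / 2 + (1 - p) / 2 = 1) // ; field.
have V := critical_pair sol l20 l2pi _ _ _ _ g1 g2.
rewrite in_itv /= in t01.
have {}V := V ltac:(lra) ltac:(lra) ltac:(lra) ltac:(lra).
by rewrite (V t t01).1 eqxx in ft.
Qed.

Lemma gamma1_dirac p : 0 < p < 1 -> gamma1 (delta p) = - 2 * pi ^+ 2.
Proof.
move=> p01.
have D1 : delta p (`]0, 1[%classic : set R) = 1%E.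
  by rewrite diracE mem_set //= in_itv.
have ub : ubound [set Re l | l in nonzero_eigenvalues (delta p)]
    (- 2 * pi ^+ 2).
  by move=> _ [l lE <-]; exact: Re_dirac_eigenvalue_le lE.
have mem : [set Re l | l in nonzero_eigenvalues (delta p)] (- 2 * pi ^+ 2).
  by exists (- 2 * pi ^+ 2)%:C => //; exact: fundamental_eigenvalue.
apply/le_anti/andP; split; first by apply: ge_sup ub; eexists; exact: mem.
by apply: ub_le_sup mem; eexists; exact: ub.
Qed.

End Deterministic.

Theorem proposition2 (R : realType) :
  (forall p : R, 0 < p < 1 ->
     gamma1 (@dirac _ (measurableTypeR R) p R) = lambdaD R 1 /\
     lambdaD R 1 = - 2 * pi ^+ 2) /\
  (forall nu : probability (measurableTypeR R) R,
     nu `]0, 1[%classic = 1%E ->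
     nonzero_eigenvalues nu (gamma1 nu)%:C ->
     gamma1 nu = lambdaD R 1 /\ lambdaD R 1 = - 2 * pi ^+ 2).
Proof.
rewrite lambdaD1; split => [p p01|nu nu1 g]; split => //.
  exact: gamma1_dirac.
exact: gamma1_real.
Qed.
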